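(* Let $L$ be a locale. The following statements are equivalent. (1) $L$ has a strongly maximal nowhere dense sublocale. (2) $\mathrm{Nd}(L)$ is nowhere dense. If $L$ is non-Boolean, these are further equivalent to: (3) $\mathrm{Nd}(L)$ is maximal nowhere dense.
   Context: A sublocale $N$ of a locale $L$ is nowhere dense if $N\cap\mathfrak{B}L=\{1\}$, where $\mathfrak{B}L=\{x\to 0:x\in L\}$. $\mathrm{Nd}(L)$ denotes the join, in the lattice of sublocales of $L$, of all nowhere dense sublocales of $L$. For a sublocale $S$ of $L$, ''$N$ is nowhere dense in $S$'' means $N\subseteq S$ and $N$ is a nowhere dense sublocale of the locale $S$. A nowhere dense sublocale $N$ of $L$ is maximal nowhere dense if there is no nowhere dense sublocale $S$ of $L$ such that $N$ is nowhere dense in $S$. A nowhere dense sublocale $N$ of $L$ is strongly maximal nowhere dense if for every nowhere dense sublocale $A$ of $L$, $N\subseteq A$ implies $A=N$. $L$ is Boolean if every element of $L$ is complemented. *)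

(* Defs.v *)
From HB Require Import structures.
From mathcomp Require Import all_boot all_order.
From mathcomp Require Import boolp classical_sets.

Set Implicit Arguments.
Unset Strict Implicit.
Unset Printing Implicit Defensive.

Import Order.TTheory.
Local Open Scope classical_set_scope.

(* A locale is identified with its frame of opens; [sups] is the join of an
   arbitrary subset. *)
HB.mixin Record TBDistrLattice_isFrame d T of Order.TBDistrLattice d T := {
  sups : set T -> T;
  sups_isLub : forall A : set T, isLub A (sups A);
  meet_supsr : forall (x : T) (A : set T),
    (x `&` sups A)%O = sups [set (x `&` a)%O | a in A];
}.

#[short(type="frameType")]
HB.structure Definition Frame d :=
  { T of TBDistrLattice_isFrame d T & Order.TBDistrLattice d T }.

(* Frames from arbitrary joins and binary meets alone; only the nontrivial
   half of the infinite distributive law is required. *)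
HB.factory Record POrder_isFrame d T of Order.POrder d T := {
  meet : T -> T -> T;
  meetP : forall x y z : T, (x <= meet y z)%O = (x <= y)%O && (x <= z)%O;
  sups : set T -> T;
  sups_isLub : forall A : set T, isLub A (sups A);
  meet_sups_le : forall (x : T) (A : set T),
    (meet x (sups A) <= sups [set meet x a | a in A])%O;
}.

HB.builders Context d T of POrder_isFrame d T.

Fact sups_ub (A : set T) x : A x -> (x <= sups A)%O.
Proof. by have [ub _] := sups_isLub A; exact: ub. Qed.

Fact sups_le (A : set T) x : (forall a, A a -> (a <= x)%O) -> (sups A <= x)%O.
Proof. by have [_ lub] := sups_isLub A; exact: lub. Qed.

Fact joinP x y z :
  (sups [set x; y] <= z)%O = (x <= z)%O && (y <= z)%O.
Proof.
apply/idP/andP => [le_z|[xz yz]]; last by apply: sups_le => a [->|->].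
by split; apply: le_trans le_z; apply: sups_ub; [left|right].
Qed.

HB.instance Definition _ := @Order.POrder_isMeetSemilattice.Build d T meet meetP.
HB.instance Definition _ := @Order.POrder_isJoinSemilattice.Build d T
  (fun x y => sups [set x; y]) joinP.

Fact le0x x : (sups set0 <= x)%O.
Proof. by apply: sups_le. Qed.

Fact lex1 x : (x <= sups setT)%O.
Proof. exact: sups_ub. Qed.

HB.instance Definition _ := @Order.hasBottom.Build d T (sups set0) le0x.
HB.instance Definition _ := @Order.hasTop.Build d T (sups setT) lex1.

Fact meet_supsr x (A : set T) :
  (x `&` sups A)%O = sups [set (x `&` a)%O | a in A].
Proof.
apply/le_anti; rewrite meet_sups_le; apply: sups_le => _ [a Aa <-].
by rewrite lexI leIl /=; apply: (le_trans (leIr _ _)); apply: sups_ub.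
Qed.

Fact meetUr : @right_distributive T T Order.meet Order.join.
Proof.
move=> x y z; rewrite -[(y `|` z)%O]/(sups [set y; z]) meet_supsr.
by rewrite image_setU !image_set1.
Qed.

Fact meetUl : @left_distributive T T Order.meet Order.join.
Proof. by move=> x y z; rewrite ![(_ `&` z)%O]meetC meetUr. Qed.

HB.instance Definition _ := Order.Lattice_Meet_isDistrLattice.Build d T meetUl.
HB.instance Definition _ :=
  TBDistrLattice_isFrame.Build d T sups_isLub meet_supsr.

HB.end.

Section FrameTheory.
Context {d : Order.disp_t} {L : frameType d}.
Implicit Types (x y z : L) (A : set L).

Lemma sups_ub A x : A x -> (x <= sups A)%O.
Proof. by have [ub _] := sups_isLub A; exact: ub. Qed.

Lemma sups_le A x : (forall a, A a -> (a <= x)%O) -> (sups A <= x)%O.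
Proof. by have [_ lub] := sups_isLub A; exact: lub. Qed.

Definition infs A : L := sups (lbound A).

Lemma infs_lb A x : A x -> (infs A <= x)%O.
Proof. by move=> Ax; apply: sups_le => y; exact. Qed.

Lemma infs_ge A x : (forall a, A a -> (x <= a)%O) -> (x <= infs A)%O.
Proof. by move=> xA; apply: sups_ub => a /xA. Qed.

Lemma infs_set2 x y : infs [set x; y] = (x `&` y)%O.
Proof.
apply/le_anti/andP; split; last first.
  by apply: infs_ge => a [->|->]; rewrite ?leIl ?leIr.
by rewrite lexI; apply/andP; split; apply: infs_lb; [left|right].
Qed.

(* Heyting implication x -> y *)
Definition imp x y : L := sups [set z | (z `&` x <= y)%O].

Lemma le_imp x y z : (z <= imp x y)%O = (z `&` x <= y)%O.
Proof.
apply/idP/idP => [le_z|]; last by move=> ?; apply: sups_ub.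
apply: (le_trans (leI2 le_z (lexx x))).
rewrite meetC meet_supsr; apply: sups_le => _ [a aP <-].
by rewrite meetC.
Qed.

End FrameTheory.

Definition boolean_locale d (L : frameType d) : Prop :=
  forall x : L, exists y : L, (x `&` y)%O = \bot%O /\ (x `|` y)%O = \top%O.

Record sublocale d (L : frameType d) := Sublocale {
  sublocale_set :> set L;
  sublocale_infs :
    forall A : set L, A `<=` sublocale_set -> sublocale_set (infs A);
  sublocale_imp :
    forall x s : L, sublocale_set s -> sublocale_set (imp x s);
}.

(* A sublocale viewed as a locale in its own right, with the order inherited
   from L. Meets (and implication) agree with those of L; joins do not, and
   neither does the bottom element. *)
Definition locale_of d (L : frameType d) (S : sublocale L) : Type :=
  {x : L | x \in (S : set L)}.

Section LocaleOf.
Context {d : Order.disp_t} {L : frameType d} (S : sublocale L).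

HB.instance Definition _ := SubChoice.on (locale_of S).
HB.instance Definition _ :=
  [SubChoice_isSubPOrder of locale_of S by <: with d].

Implicit Types (a b c : locale_of S) (A : set (locale_of S)).

Definition mkS (x : L) (Sx : (S : set L) x) : locale_of S :=
  exist _ x (mem_set Sx).

Lemma valS a : (S : set L) (val a).
Proof. exact: set_mem (valP a). Qed.

Let meetS_subproof a b : (S : set L) (val a `&` val b)%O.
Proof.
by rewrite -infs_set2; apply: sublocale_infs => _ [->|->]; exact: valS.
Qed.

Let meetS a b : locale_of S := mkS (meetS_subproof a b).

Let ubS A : set L := [set s | (S : set L) s /\ forall a, A a -> (val a <= s)%O].

Let supsS_subproof A : (S : set L) (infs (ubS A)).
Proof. by apply: sublocale_infs => s []. Qed.

Let supsS A : locale_of S := mkS (supsS_subproof A).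

Let meetSP a b c : (a <= meetS b c)%O = (a <= b)%O && (a <= c)%O.
Proof. by rewrite -!Order.le_val lexI. Qed.

Let supsS_isLub A : isLub A (supsS A).
Proof.
split=> [a Aa|b Ab]; rewrite -Order.le_val /=.
  by apply: infs_ge => s [_]; apply.
by apply: infs_lb; split=> [|a /Ab]; [exact: valS | rewrite -Order.le_val].
Qed.

Let meetS_sups_le a A :
  (meetS a (supsS A) <= supsS [set meetS a b | b in A])%O.
Proof.
rewrite -Order.le_val /=; apply: infs_ge => s [Ss ub_s].
rewrite meetC -le_imp; apply: infs_lb; split; first exact: sublocale_imp.
by move=> b Ab; rewrite le_imp meetC; apply: (ub_s (meetS a b)); exists b.
Qed.

HB.instance Definition _ := POrder_isFrame.Build d (locale_of S)
  meetSP supsS_isLub meetS_sups_le.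

Lemma val_meetS a b : val (a `&` b)%O = (val a `&` val b)%O.
Proof. by []. Qed.

Lemma val_topS : val (\top%O : locale_of S) = \top%O.
Proof.
have S1 : (S : set L) \top%O.
  suff -> : \top%O = infs (set0 : set L) by exact: sublocale_infs.
  by apply: le_anti; rewrite lex1 andbT; apply: infs_ge.
apply: le_anti; rewrite lex1 /=.
by have := lex1 (mkS S1); rewrite -Order.le_val.
Qed.

Lemma val_botS : val (\bot%O : locale_of S) = infs S.
Proof.
have S0 : (S : set L) (infs S) by exact: sublocale_infs.
apply/le_anti/andP; split; last by apply: infs_lb; exact: valS.
by have := le0x (mkS S0); rewrite -Order.le_val.
Qed.

Lemma val_impS a b : val (imp a b) = imp (val a) (val b).
Proof.
apply/le_anti/andP; split.
  by rewrite le_imp -val_meetS Order.le_val -le_imp.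
have Si : (S : set L) (imp (val a) (val b)).
  by apply: sublocale_imp; exact: valS.
suff : (mkS Si <= imp a b)%O by rewrite -Order.le_val.
by rewrite le_imp -Order.le_val val_meetS /= -le_imp.
Qed.

End LocaleOf.

Section SublocaleJoin.
Context {d : Order.disp_t} {L : frameType d}.
Implicit Types (S T : sublocale L) (F : set (sublocale L)).

(* Join in the lattice of sublocales ordered by inclusion. *)
Definition join_set F : set L :=
  \bigcap_(T in [set T : sublocale L | forall S, F S -> S `<=` T]) T.

Fact join_infs F A : A `<=` join_set F -> join_set F (infs A).
Proof.
by move=> AF T FT; apply: sublocale_infs => x /AF; apply.
Qed.

Fact join_imp F x s : join_set F s -> join_set F (imp x s).
Proof. by move=> Fs T FT; apply: sublocale_imp; apply: Fs. Qed.

Definition sublocale_join F : sublocale L :=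
  Sublocale (@join_infs F) (@join_imp F).

Lemma sublocale_join_ub F S : F S -> S `<=` sublocale_join F.
Proof. by move=> FS x Sx T FT; apply: FT Sx. Qed.

Lemma sublocale_join_least F T :
  (forall S, F S -> S `<=` T) -> sublocale_join F `<=` T.
Proof. by move=> FT x; apply. Qed.

End SublocaleJoin.

Definition booleanization d (L : frameType d) : set L :=
  [set imp x \bot%O | x in [set: L]].
Arguments booleanization {d} L.

Definition nowhere_dense d (L : frameType d) (N : sublocale L) : Prop :=
  N `&` booleanization L = [set \top%O].

Definition Nd d (L : frameType d) : sublocale L :=
  sublocale_join [set N | nowhere_dense N].
Arguments Nd {d} L.

(* M is N regarded as a sublocale of the locale S, so that \bot in
   [nowhere_dense M] is the bottom of S. *)
Definition nowhere_dense_in d (L : frameType d) (N S : sublocale L) : Prop :=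
  N `<=` S /\
  exists M : sublocale (locale_of S), val @` M = N /\ nowhere_dense M.

Definition maximal_nowhere_dense d (L : frameType d) (N : sublocale L) : Prop :=
  nowhere_dense N /\
  ~ exists S : sublocale L, nowhere_dense S /\ nowhere_dense_in N S.

Definition strongly_maximal_nowhere_dense d (L : frameType d)
    (N : sublocale L) : Prop :=
  nowhere_dense N /\
  forall A : sublocale L, nowhere_dense A -> N `<=` A -> A = N.

(* Main.v *)
(* A sublocale N is nowhere dense iff its least element has pseudocomplement 0;
   hence binary joins of nowhere dense sublocales are nowhere dense, and a
   strongly maximal one must contain all the others.  If L is not Boolean, some
   dense element x \/ x* differs from 1, so the closed sublocale above it is a
   nontrivial part of Nd(L); as a nontrivial sublocale is never nowhere dense
   in itself, Nd(L) is nowhere dense in no nowhere dense sublocale. *)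
Require Import Defs.
From mathcomp Require Import all_boot all_order.
From mathcomp Require Import boolp classical_sets.

Set Implicit Arguments.
Unset Strict Implicit.
Unset Printing Implicit Defensive.

Import Order.TTheory.
Local Open Scope classical_set_scope.

Section NowhereDense.
Context {d : Order.disp_t} {L : frameType d}.
Implicit Types (x y z c : L) (N S A : sublocale L).

Lemma le_imp_self x y : (y <= imp x y)%O.
Proof. by rewrite le_imp leIl. Qed.

Lemma impIl_bot x : (imp x \bot `&` x <= \bot :> L)%O.
Proof. by rewrite -le_imp. Qed.

Lemma sublocale_top S : (S : set L) \top%O.
Proof. by rewrite -(val_topS S); exact: valS. Qed.

Lemma sublocale_bot S : (S : set L) (infs S).
Proof. exact: sublocale_infs. Qed.

Lemma sublocale_eq S A : (S : set L) = A -> S = A.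
Proof.
case: S A => [S i p] [A j q] /= E; case: _ / E j q => j q.
by rewrite (Prop_irrelevance i j) (Prop_irrelevance p q).
Qed.

Lemma top_booleanization : booleanization L \top%O.
Proof.
by exists \bot%O => //; apply: le_anti; rewrite lex1 le_imp leIr.
Qed.

Lemma bot_booleanization : booleanization L \bot%O.
Proof.
by exists \top%O => //; apply: le_anti; rewrite le0x andbT -{1}[imp _ _]meetx1
  impIl_bot.
Qed.

Lemma nowhere_dense_sub N :
  (forall x, (N : set L) x -> booleanization L x -> x = \top%O) ->
  nowhere_dense N.
Proof.
move=> h; rewrite /nowhere_dense eqEsubset; split=> [x [Nx Bx]|_ ->]; first exact: h.
by split; [exact: sublocale_top | exact: top_booleanization].
Qed.

Lemma nowhere_dense_eq_top N x :
  nowhere_dense N -> (N : set L) x -> booleanization L x -> x = \top%O.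
Proof.
move=> ndN Nx Bx; have : (N `&` booleanization L) x by split.
by rewrite ndN.
Qed.

Lemma nowhere_dense_subset N S :
  N `<=` S -> nowhere_dense S -> nowhere_dense N.
Proof.
by move=> NS ndS; apply: nowhere_dense_sub => x /NS; exact: nowhere_dense_eq_top.
Qed.

(** From [c <= y -> 0] one gets [y <= c -> 0 = 0], so [y -> 0] is top. *)
Lemma dense_booleanization_top c x :
  imp c \bot%O = \bot%O :> L -> booleanization L x -> (c <= x)%O -> x = \top%O.
Proof.
move=> c0 [y _ <-]; rewrite le_imp meetC -le_imp c0 => y0.
by apply: le_anti; rewrite lex1 le_imp (le_trans (leIr _ _)).
Qed.

(** The double pseudocomplement of the least element lies in the Booleanization and, by closure
    under implication, also in [N]. *)
Lemma nowhere_dense_infs N :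
  nowhere_dense N -> imp (infs N) \bot%O = \bot%O :> L.
Proof.
move=> ndN; set n := infs N; set p := imp n \bot%O.
(* [p -> n] and [p -> 0] agree because [p /\ n = 0], and the former lies in N. *)
have pE : imp p n = imp p \bot%O.
  apply: le_anti; apply/andP; split; rewrite le_imp; last first.
    exact: le_trans (impIl_bot _) (le0x _).
  by apply: le_trans (impIl_bot n); rewrite lexI leIr -le_imp lexx.
have p1 : imp p \bot%O = \top%O.
  apply: (nowhere_dense_eq_top ndN); last by exists p.
  by rewrite -pE; apply: sublocale_imp; exact: sublocale_bot.
by apply: le_anti; rewrite le0x andbT; have := impIl_bot p; rewrite p1 meet1x.
Qed.

Lemma above_infs c (A : set L) : A `<=` [set x | (c <= x)%O] -> (c <= infs A)%O.
Proof. by move=> Ac; apply: infs_ge. Qed.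

Lemma above_imp c x y : (c <= y)%O -> (c <= imp x y)%O.
Proof. by move=> cy; exact: le_trans cy (le_imp_self x y). Qed.

Definition closed_sublocale c : sublocale L :=
  @Sublocale d L [set x | (c <= x)%O] (@above_infs c) (@above_imp c).

Lemma nowhere_dense_closed c :
  imp c \bot%O = \bot%O :> L -> nowhere_dense (closed_sublocale c).
Proof.
by move=> c0; apply: nowhere_dense_sub => x /= cx Bx; exact: dense_booleanization_top cx.
Qed.

(** If [w] is the pseudocomplement of the meet, [w /\ x] lies below [y -> 0 = 0], so [w] lies below
    [x -> 0 = 0]. *)
Lemma imp_meet_bot x y :
  imp x \bot%O = \bot%O :> L -> imp y \bot%O = \bot%O :> L ->
  imp (x `&` y)%O \bot%O = \bot%O :> L.
Proof.
move=> x0 y0; apply: le_anti; rewrite le0x andbT.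
have : (imp (x `&` y) \bot `&` x <= imp y \bot :> L)%O.
  by rewrite le_imp -meetA impIl_bot.
by rewrite y0 -le_imp x0.
Qed.

(** The join lies in the closed sublocale above the meet of the two least elements, and that meet is
    again dense. *)
Lemma nowhere_dense_join2 N S : nowhere_dense N -> nowhere_dense S ->
  nowhere_dense (sublocale_join [set N; S]).
Proof.
move=> ndN ndS.
pose c := (infs N `&` infs S)%O.
apply: (@nowhere_dense_subset _ (closed_sublocale c)).
  apply: sublocale_join_least => _ [->|->] x Tx /=.
    exact: le_trans (leIl _ _) (infs_lb Tx).
  exact: le_trans (leIr _ _) (infs_lb Tx).
by apply/nowhere_dense_closed/imp_meet_bot; exact: nowhere_dense_infs.
Qed.

Lemma Nd_ub N : nowhere_dense N -> N `<=` Nd L.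
Proof. by move=> ndN; exact: sublocale_join_ub. Qed.

(** Maximality forces the join of [N] and [S] to equal [N]. *)
Lemma strongly_maximal_ub N S :
  strongly_maximal_nowhere_dense N -> nowhere_dense S -> S `<=` N.
Proof.
move=> [ndN maxN] ndS.
rewrite -(maxN _ (nowhere_dense_join2 ndN ndS)).
  by apply: sublocale_join_ub; right.
by apply: sublocale_join_ub; left.
Qed.

Lemma imp_join_bot x : imp (x `|` imp x \bot)%O \bot%O = \bot%O :> L.
Proof.
set y := imp (x `|` _)%O _; apply: le_anti; rewrite le0x andbT.
(* [y] is disjoint from [x], hence below [x -> 0] and so below the very join it is disjoint from. *)
have yx : (y <= imp x \bot)%O.
  by rewrite le_imp; apply: le_trans (impIl_bot (x `|` imp x \bot)%O);
    rewrite leI2 ?leUl.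
apply: le_trans (impIl_bot (x `|` imp x \bot)%O).
by rewrite lexI lexx (le_trans yx) ?leUr.
Qed.

(** The closed sublocale above [x \/ (x -> 0)] lies in [Nd L], so this join must be top. *)
Lemma boolean_Nd : Nd L `<=` [set \top%O] -> boolean_locale L.
Proof.
move=> Nd1 x; exists (imp x \bot%O); split.
  by apply: le_anti; rewrite le0x andbT meetC impIl_bot.
by apply/Nd1/(Nd_ub (nowhere_dense_closed (imp_join_bot x))) => /=.
Qed.

End NowhereDense.

(** The bottom of the locale [S] lies both in [M] and in the Booleanization of [S], so it is top and
    [S] collapses. *)
Lemma nowhere_dense_in_self d (L : frameType d) (N S : sublocale L) :
  S `<=` N -> nowhere_dense_in N S -> N `<=` [set \top%O].
Proof.
move=> SN [NS [M [MN ndM]]] x /NS Sx.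
have M0 : (M : set _) \bot%O.
  have : (N : set L) (val (\bot%O : locale_of S)) by apply: SN; exact: valS.
  by rewrite -MN => -[m Mm /val_inj <-].
have bot1 := nowhere_dense_eq_top ndM M0 bot_booleanization.
have : (\bot <= mkS Sx)%O by exact: le0x.
rewrite bot1 -Order.le_val val_topS /= => x1.
by apply: le_anti; rewrite lex1.
Qed.

Theorem proposition2p14 (d : Order.disp_t) (L : frameType d) :
  ((exists N : sublocale L, strongly_maximal_nowhere_dense N)
     <-> nowhere_dense (Nd L))
  /\ (~ boolean_locale L ->
      (nowhere_dense (Nd L) <-> maximal_nowhere_dense (Nd L))).
Proof.
split; [split=> [[N maxN]|ndNd] | move=> nonbool; split=> [ndNd|[]//]].
- apply: (nowhere_dense_subset _ maxN.1).
  by apply: sublocale_join_least => S; exact: strongly_maximal_ub.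
- exists (Nd L); split=> // A ndA NdA.
  by apply/sublocale_eq/seteqP; split=> //; exact: Nd_ub.
(* Being nowhere dense, [S] lies inside [Nd L], so [Nd L] would be trivial and [L] Boolean. *)
- split=> // -[S [ndS inS]]; apply/nonbool/boolean_Nd.
  exact: nowhere_dense_in_self (Nd_ub ndS) inS.
Qed.
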